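(* Let $\psi$ and $G_\psi$ be as constructed below. Then $G_\psi$ has a Pareto-optimal matching $M$ with $\mathsf{cost}(M)=0$ if and only if $\psi$ is satisfiable.
   Context: Matchings and preferences: node $u$ prefers matching $M$ to $N$ if $u$ is matched in $M$ and unmatched in $N$, or matched in both and prefers its partner in $M$; $\phi(M,N)$ is the number of nodes preferring $M$ to $N$. A matching $M$ is Pareto-optimal if there is no matching $N$ with $\phi(N,M)>0$ and $\phi(M,N)=0$. $\mathsf{cost}(M)=\sum_{e\in M}\mathsf{cost}(e)$. The formula: $\psi_0$ is a 3-CNF formula over $X_1,\ldots,X_n$, each clause having three literals on distinct variables. $\psi$ is obtained by replacing every occurrence of $\neg X_i$ by a new variable $X_{n+i}$ and adding clauses $(X_i\vee X_{n+i})$ and $(\neg X_i\vee\neg X_{n+i})$ for each $i\in[n]$. Clauses of $\psi$ containing only unnegated variables are positive (2 or 3 literals); the others are the negative clauses $(\neg X_i\vee\neg X_{n+i})$; each variable occurs negated exactly once. The graph $G_\psi$ (bipartite; nodes named $a,a',c,c'$ on one side, $b,b',d,d'$ on the other): for each positive clause $C_\ell$ and each variable $x$ in it, nodes $a_{x,\ell},a'_{x,\ell},b_{x,\ell},b'_{x,\ell}$ with gadget edges $(a_{x,\ell},b_{x,\ell}),(a_{x,\ell},b'_{x,\ell}),(a'_{x,\ell},b_{x,\ell}),(a'_{x,\ell},b'_{x,\ell})$. For each variable $r$, nodes $c_r,c'_r,d_r,d'_r$ with gadget edges $(c_r,d_r),(c_r,d'_r),(c'_r,d_r),(c'_r,d'_r)$.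 For a positive clause $C_\ell$ with variables in a fixed cyclic order $v_1,\ldots,v_k$ ($k\in\{2,3\}$, indices mod $k$), add edges $(a_{v_j,\ell},b_{v_{j-1},\ell})$. For a negative clause $\neg x\vee\neg y$, add edges $(c_x,d_y),(c_y,d_x)$. For each occurrence of $x$ in a positive clause $C_\ell$, add consistency edges $(a_{x,\ell},d'_x)$ and $(c_x,b'_{x,\ell})$. Preferences (most preferred first): $a_{v_j,\ell}$: $b_{v_{j-1},\ell}\succ b_{v_j,\ell}\succ d'_{v_j}\succ b'_{v_j,\ell}$; $a'_{v_j,\ell}$: $b_{v_j,\ell}\succ b'_{v_j,\ell}$; $b_{v_j,\ell}$: $a_{v_{j+1},\ell}\succ a_{v_j,\ell}\succ a'_{v_j,\ell}$; $b'_{v_j,\ell}$: $a'_{v_j,\ell}\succ c_{v_j}\succ a_{v_j,\ell}$. For the negative clause $\neg x\vee\neg y$ (and symmetrically with $x,y$ swapped): $c_x$: $d_y\succ d_x\succ$ (all $b'_{x,\ell}$ over positive occurrences of $x$, in any order) $\succ d'_x$; $c'_x$: $d_x\succ d'_x$; $d_x$: $c_y\succ c_x\succ c'_x$; $d'_x$: $c'_x\succ$ (all $a_{x,\ell}$, in any order) $\succ c_x$. Edge costs: $\mathsf{cost}(e)=0$ for the four gadget edges of each $\{a_{x,\ell},a'_{x,\ell},b_{x,\ell},b'_{x,\ell}\}$ and each $\{c_r,c'_r,d_r,d'_r\}$; $\mathsf{cost}(e)=1$ for all other edges. *)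

(* Defs.v *)
From HB Require Import structures.
From mathcomp Require Import all_boot.
Set Implicit Arguments.
Unset Strict Implicit.
Unset Printing Implicit Defensive.

(* Graphs with strict preference lists: [E] is the set of edges, each edge
   being a two-element set of nodes, and [pref u] lists the neighbours of [u],
   most preferred first. *)
Section Matchings.

Variables (V : finType) (E : {set {set V}}) (pref : V -> seq V).
Implicit Types (M N : {set {set V}}) (u v w : V).

Definition is_matching M : bool := (M \subset E) && trivIset M.

Definition matched M u : bool := u \in cover M.

Definition better u v w : bool := index v (pref u) < index w (pref u).

Definition prefers u M N : bool :=
  (matched M u && ~~ matched N u)
  || [exists v, exists w,
        [&& [set u; v] \in M, [set u; w] \in N & better u v w]].

Definition phi M N : nat := #|[set u | prefers u M N]|.

Definition pareto_optimal M : Prop :=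
  is_matching M /\
  ~ (exists N, [/\ is_matching N, 0 < phi N M & phi M N = 0]).

Definition matching_cost (cost : {set V} -> nat) M : nat :=
  \sum_(e in M) cost e.

End Matchings.

(* [(x, true)] is the literal x and [(x, false)] its negation. *)
Definition literal (N : nat) := ('I_N * bool)%type.
Definition clause (N : nat) := seq (literal N).
Definition cnf (N : nat) := seq (clause N).

Definition clause_vars (N : nat) (C : clause N) : seq 'I_N := [seq l.1 | l <- C].

Definition satisfiable (N : nat) (f : cnf N) : Prop :=
  exists v : 'I_N -> bool, all (has (fun l => v l.1 == l.2)) f.

(* [lshift n i] is the variable X_i and [rshift n i] the variable X_{n+i}. *)
Definition unneg (n : nat) (l : literal n) : literal (n + n) :=
  if l.2 then (lshift n l.1, true) else (rshift n l.1, true).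

Definition psi (n : nat) (psi0 : seq (3.-tuple (literal n))) : cnf (n + n) :=
  [seq [seq unneg l | l <- C] | C : 3.-tuple (literal n) <- psi0]
  ++ [seq [:: (lshift n i, true); (rshift n i, true)] | i <- enum 'I_n]
  ++ [seq [:: (lshift n i, false); (rshift n i, false)] | i <- enum 'I_n].

(* The variable y such that (~ x \/ ~ y) is a negative clause of psi. *)
Definition mate (n : nat) (x : 'I_(n + n)) : 'I_(n + n) :=
  match split x with inl i => rshift n i | inr i => lshift n i end.

Section Gadgets.

Variables (N : nat) (f : cnf N).

Definition pos_clauses : cnf N := [seq C <- f | all (fun l => l.2) C].

Definition neg_pair (x y : 'I_N) : bool :=
  ([:: (x, false); (y, false)] \in f) || ([:: (y, false); (x, false)] \in f).

(* Positive clauses are identified by their position l; the cyclic order on the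
   variables of a clause is the one in which the clause lists them. *)
Definition pos_vars (l : 'I_(size pos_clauses)) : seq 'I_N :=
  clause_vars (nth [::] pos_clauses l).

Definition occ : Type :=
  {p : 'I_N * 'I_(size pos_clauses) | p.1 \in pos_vars p.2}.

Definition occ_var (o : occ) : 'I_N := (val o).1.
Definition occ_clause (o : occ) : 'I_(size pos_clauses) := (val o).2.

Lemma occ_prev_subproof (o : occ) :
  prev (pos_vars (occ_clause o)) (occ_var o) \in pos_vars (occ_clause o).
Proof. by rewrite mem_prev; apply: (valP o). Qed.

Lemma occ_next_subproof (o : occ) :
  next (pos_vars (occ_clause o)) (occ_var o) \in pos_vars (occ_clause o).
Proof. by rewrite mem_next; apply: (valP o). Qed.

Definition occ_prev (o : occ) : occ :=
  exist (fun p => p.1 \in pos_vars p.2) (_, _) (occ_prev_subproof o).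

Definition occ_next (o : occ) : occ :=
  exist (fun p => p.1 \in pos_vars p.2) (_, _) (occ_next_subproof o).

Inductive node : Type :=
  | NA of occ | NA' of occ | NB of occ | NB' of occ
  | NC of 'I_N | NC' of 'I_N | ND of 'I_N | ND' of 'I_N.

Definition node_code (u : node) : 'I_4 * (occ + 'I_N) :=
  match u with
  | NA o => (inord 0, inl o) | NA' o => (inord 1, inl o)
  | NB o => (inord 2, inl o) | NB' o => (inord 3, inl o)
  | NC x => (inord 0, inr x) | NC' x => (inord 1, inr x)
  | ND x => (inord 2, inr x) | ND' x => (inord 3, inr x)
  end.

Definition node_decode (p : 'I_4 * (occ + 'I_N)) : node :=
  match p with
  | (k, inl o) => nth NA [:: NA; NA'; NB; NB'] k o
  | (k, inr x) => nth NC [:: NC; NC'; ND; ND'] k x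
  end.

Lemma node_codeK : cancel node_code node_decode.
Proof. by case=> z; rewrite /node_decode /= inordK. Qed.

HB.instance Definition _ := Finite.copy node (can_type node_codeK).

Definition gadget_adj (u v : node) : bool :=
  match u, v with
  | NA o, NB p | NA o, NB' p | NA' o, NB p | NA' o, NB' p => o == p
  | NC x, ND y | NC x, ND' y | NC' x, ND y | NC' x, ND' y => x == y
  | _, _ => false
  end.

Definition other_adj (u v : node) : bool :=
  match u, v with
  | NA o, NB p => p == occ_prev o
  | NC x, ND y => neg_pair x y
  | NA o, ND' x => x == occ_var o
  | NC x, NB' o => x == occ_var o
  | _, _ => false
  end.

Definition gadget_edges : {set {set node}} :=
  [set [set uv.1; uv.2] | uv : node * node & gadget_adj uv.1 uv.2].

Definition other_edges : {set {set node}} :=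
  [set [set uv.1; uv.2] | uv : node * node & other_adj uv.1 uv.2].

Definition edges : {set {set node}} := gadget_edges :|: other_edges.

Definition edge_cost (e : {set node}) : nat :=
  if e \in gadget_edges then 0 else 1.

(* [s x] is an enumeration, in some order, of the positive occurrences of x. *)
Definition occ_order (s : 'I_N -> seq occ) : Prop :=
  forall x, perm_eq (s x) (enum [pred o : occ | occ_var o == x]).

End Gadgets.

Section Preferences.

Variables (n : nat) (f : cnf (n + n)).

(* The orders in which c_x ranks the nodes b'_{x,l} and d'_x ranks the nodes
   a_{x,l} are given by [sc x] and [sd x]. *)
Variables (sc sd : 'I_(n + n) -> seq (occ f)).

Definition prefs (u : node f) : seq (node f) :=
  match u with
  | NA o => [:: NB (occ_prev o); NB o; ND' f (occ_var o); NB' o]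
  | NA' o => [:: NB o; NB' o]
  | NB o => [:: NA (occ_next o); NA o; NA' o]
  | NB' o => [:: NA' o; NC f (occ_var o); NA o]
  | NC x => [:: ND f (mate x), ND f x & rcons [seq NB' o | o <- sc x] (ND' f x)]
  | NC' x => [:: ND f x; ND' f x]
  | ND x => [:: NC f (mate x); NC f x; NC' f x]
  | ND' x => NC' f x :: rcons [seq NA o | o <- sd x] (NC f x)
  end.

End Preferences.

Section Consistency.

Variables (n : nat) (psi0 : seq (3.-tuple (literal n))).
Implicit Types x y : 'I_(n + n).

Lemma mateK : involutive (@mate n).
Proof.
by move=> x; rewrite -[x]splitK /mate; case: (split x) => i /=;
  rewrite !(unsplitK (inl _ i), unsplitK (inr _ i)).
Qed.

Lemma mate_neq x : mate x != x.
Proof.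
rewrite -[x in X in _ != X]splitK /mate; case: (split x) => i /=.
  by rewrite eq_rlshift.
by rewrite eq_lrshift.
Qed.

Lemma pos_clauses_psi : pos_clauses (psi psi0) =
  [seq [seq unneg l | l <- C] | C : 3.-tuple (literal n) <- psi0]
  ++ [seq [:: (lshift n i, true); (rshift n i, true)] | i <- enum 'I_n].
Proof.
rewrite /pos_clauses /psi !filter_cat.
congr (_ ++ _).
  apply/all_filterP/allP => C /mapP [D _ ->]; rewrite all_map.
  by apply/allP => -[i []].
rewrite -[RHS]cats0; congr (_ ++ _).
  by apply/all_filterP/allP => C /mapP [i _ ->].
by apply/eqP; rewrite -size_eq0 size_filter -leqn0 leqNgt -has_count;
  apply/hasPn => C /mapP [i _ ->].
Qed.

Lemma neg_clause_psi x y : ([:: (x, false); (y, false)] \in psi psi0) =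
  [exists i, (x == lshift n i) && (y == rshift n i)].
Proof.
rewrite /psi !mem_cat; apply/idP/existsP => [|[i /andP [/eqP -> /eqP ->]]].
  case/or3P => /mapP [].
  - by move=> C _ /(congr1 size); rewrite size_map size_tuple.
  - by move=> i _ [].
  by move=> i _ [-> ->]; exists i; rewrite !eqxx.
by apply/or3P/Or33/map_f; rewrite mem_enum.
Qed.

Lemma neg_pair_psi x y : neg_pair (psi psi0) x y = (y == mate x).
Proof.
rewrite /neg_pair !neg_clause_psi; apply/orP/eqP => [|->].
  case=> /existsP [i /andP [/eqP -> /eqP ->]]; rewrite /mate.
    by rewrite (unsplitK (inl _ i)).
  by rewrite (unsplitK (inr _ i)).
rewrite -[x]splitK /mate; case: (split x) => i /=.
  by left; apply/existsP; exists i; rewrite (unsplitK (inl _ i)) !eqxx.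
by right; apply/existsP; exists i; rewrite (unsplitK (inr _ i)) !eqxx.
Qed.

Hypothesis distinct_vars : forall C : 3.-tuple (literal n),
  C \in psi0 -> uniq (clause_vars C).

Lemma unneg_inj (l k : literal n) : (unneg l).1 = (unneg k).1 -> l.1 = k.1.
Proof.
by rewrite /unneg; case: l k => [i []] [j []] /= /eqP;
  rewrite ?eq_lshift ?eq_rshift ?eq_lrshift ?eq_rlshift // => /eqP.
Qed.

Lemma pos_vars_uniq l : uniq (pos_vars (f := psi psi0) l).
Proof.
rewrite /pos_vars; move: (mem_nth [::] (ltn_ord l)); set C := nth _ _ _.
rewrite pos_clauses_psi mem_cat => /orP [] /mapP [] => [D /distinct_vars uD|i _] ->.
  rewrite /clause_vars -map_comp.
  elim: (tval D) uD => //= k s IH /andP [ks /IH ->]; rewrite andbT.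
  apply: contra ks => /mapP [m ms /unneg_inj e]; apply/mapP; by exists m.
by rewrite /= inE eq_lrshift.
Qed.

Lemma pos_vars_size l : 1 < size (pos_vars (f := psi psi0) l).
Proof.
rewrite /pos_vars; move: (mem_nth [::] (ltn_ord l)); set C := nth _ _ _.
rewrite pos_clauses_psi mem_cat => /orP [] /mapP [] => [D _|i _] -> //.
by rewrite /clause_vars !size_map size_tuple.
Qed.

Lemma occ_prevK : cancel (@occ_prev _ (psi psi0)) (@occ_next _ (psi psi0)).
Proof.
case=> -[x l] xl; apply: val_inj => /=; congr (_, _).
exact/next_prev/pos_vars_uniq.
Qed.

Lemma occ_nextK : cancel (@occ_next _ (psi psi0)) (@occ_prev _ (psi psi0)).
Proof.
case=> -[x l] xl; apply: val_inj => /=; congr (_, _).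
exact/prev_next/pos_vars_uniq.
Qed.

Lemma edgesP (f := psi psi0) (u v : node f) :
  ([set u; v] \in edges f) =
  [|| gadget_adj u v, gadget_adj v u, other_adj u v | other_adj v u].
Proof.
have H (r : rel (node f)) : irreflexive r ->
    ([set u; v] \in [set [set p.1; p.2] | p : node f * node f & r p.1 p.2])
    = r u v || r v u.
  move=> irr; apply/imsetP/orP => [[[s t]] /[!inE] /= rst e|].
    have [us vs] : u \in [set s; t] /\ v \in [set s; t] by rewrite -e !inE !eqxx orbT.
    have [su tv] : s \in [set u; v] /\ t \in [set u; v] by rewrite e !inE !eqxx orbT.
    have st : s != t by apply: contraTneq rst => ->; rewrite irr.
    move: us vs su tv st rst; rewrite !inE.
    case/orP=> /eqP <-; case/orP => /eqP <-; rewrite ?eqxx ?orbT //=; try by auto.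
      by move=> _; rewrite orbb => /eqP ->; rewrite eqxx.
    by rewrite orbb => /eqP ->; rewrite eqxx.
  case=> ruv; [exists (u, v) | exists (v, u)] => //=; rewrite ?inE //.
  by rewrite setUC.
by rewrite inE !H ?orbA //; case.
Qed.

Variables sc sd : 'I_(n + n) -> seq (occ (psi psi0)).
Hypotheses (sc_order : occ_order sc) (sd_order : occ_order sd).

Lemma node_eqE (f := psi psi0) (u v : node f) : (u == v) =
  match u, v with
  | NA o, NA p | NA' o, NA' p | NB o, NB p | NB' o, NB' p => o == p
  | NC x, NC y | NC' x, NC' y | ND x, ND y | ND' x, ND' y => x == y
  | _, _ => false
  end.
Proof.
by case: u => z; case: v => t; first [by apply/eqP | by apply/eqP/eqP => [[]|->]].
Qed.

Lemma mem_map_occ (f := psi psi0) (K : occ f -> node f) x u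
    (s : 'I_(n + n) -> seq (occ f)) : occ_order s ->
  (u \in [seq K o | o <- s x]) = [exists o, (u == K o) && (occ_var o == x)].
Proof.
move=> p; apply/mapP/existsP => [[o os ->]|[o /andP [/eqP -> ox]]].
  by exists o; move: os; rewrite (perm_mem (p x)) mem_enum inE eqxx.
by exists o => //; rewrite (perm_mem (p x)) mem_enum inE.
Qed.

Lemma mem_prefs (u v : node (psi psi0)) :
  (v \in prefs sc sd u) = ([set u; v] \in edges (psi psi0)).
Proof.
have prevE o p : (p == occ_next o) = (o == occ_prev p :> occ (psi psi0)).
  by rewrite eq_sym (can2_eq occ_nextK occ_prevK).
have mateE x y : (x == mate y) = (y == mate x) by rewrite eq_sym (inv_eq mateK).
have exK (K : occ (psi psi0) -> node (psi psi0)) o x :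
    injective K -> [exists p, (K o == K p) && (occ_var p == x)] = (x == occ_var o).
  move=> Ki; rewrite eq_sym.
  by apply/existsP/idP => [[p /andP [/eqP /Ki <-]] //|ro]; exists o; rewrite eqxx.
have exN (K : occ (psi psi0) -> node (psi psi0)) w x : (forall o, w <> K o) ->
    [exists p, (w == K p) && (occ_var p == x)] = false.
  by move=> wK; apply/existsP => -[o /andP [/eqP /wK]].
rewrite edgesP; case: u => z; case: v => t.
all: rewrite /= ?(in_cons, mem_rcons, in_nil) ?mem_map_occ // ?node_eqE ?orbF //=.
all: rewrite ?neg_pair_psi ?prevE ?(mateE z t) ?exK ?exN ?orbF //; try by move=> ? ? [].
all: by rewrite ?[t == z]eq_sym // orbC.
Qed.

Lemma uniq_prefs (u : node (psi psi0)) : uniq (prefs sc sd u).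
Proof.
have next_neq o : occ_next o != o :> occ (psi psi0).
  have us := pos_vars_uniq (occ_clause o).
  have ss := pos_vars_size (occ_clause o).
  have [i s Es] := rot_to (valP o).
  apply/eqP => /(congr1 (@occ_var _ _)); rewrite {1}/occ_var /= -(next_rot i us).
  move: us ss; rewrite -(rot_uniq i) -(size_rot i) Es.
  case: s {Es} => //= y s; rewrite inE negb_or eqxx => /andP [/andP [xy _] _] _ e.
  by rewrite /occ_var e eqxx in xy.
have prev_neq o : occ_prev o != o :> occ (psi psi0).
  by rewrite -(inj_eq (can_inj occ_nextK)) occ_prevK eq_sym.
have sU s x : occ_order s -> uniq (s x : seq (occ (psi psi0))).
  by move=> /(_ x) /perm_uniq ->; apply: enum_uniq.
have mapN (K : occ (psi psi0) -> node (psi psi0)) w r : (forall o, w <> K o) ->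
    w \in [seq K p | p <- r] = false.
  by move=> wK; apply/mapP => -[o _ /wK].
case: u => z; rewrite /= ?rcons_uniq ?map_inj_uniq ?sU // ?(in_cons, mem_rcons, in_nil).
all: rewrite ?node_eqE ?orbF /= ?andbT ?mapN ?orbF ?mate_neq //.
all: by move=> ? ? [].
Qed.

End Consistency.

(* Main.v *)
Require Import Defs.
From HB Require Import structures.
From mathcomp Require Import all_boot.
Set Implicit Arguments.
Unset Strict Implicit.
Unset Printing Implicit Defensive.

(** A zero-cost Pareto-optimal matching lives inside the gadgets, and it must
    match each of them perfectly, in one of two ways.  Read [c_x - d_x] as "x is
    true" and [a_{x,l} - b'_{x,l}] as "x makes the clause l true".  Each way of
    contradicting satisfaction opens an alternating cycle along which every
    node improves: the consistency edges when an occurrence is true and its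
    variable is not, the clause edges when no occurrence of the clause is
    true, the edges of a negative clause when both of its variables are true.
    Conversely, in the matching read off a satisfying assignment enough nodes
    have their first choice to freeze all the gadgets one after the other;
    around a positive clause the freezing starts at a true occurrence. *)

(** * Perfect matchings as involutions *)

Lemma set2_eqr (T : finType) (u v w : T) : [set u; v] = [set u; w] -> v = w.
Proof.
move=> e; have : v \in [set u; w] by rewrite -e set22.
case/set2P => // vu; have : w \in [set u; v] by rewrite e set22.
by rewrite vu => /set2P [] ->.
Qed.

Lemma trivIset_eq (T : finType) (P : {set {set T}}) (A B : {set T}) x :
  trivIset P -> A \in P -> B \in P -> x \in A -> x \in B -> A = B.
Proof.
move=> tP AP BP xA xB.
by rewrite -(def_pblock tP AP xA) (def_pblock tP BP xB).
Qed.

Section PartnerMaps.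

Variables (V : finType) (E : {set {set V}}) (pref : V -> seq V).
Implicit Types (M : {set {set V}}) (u v w : V) (f g h : V -> V).

Hypothesis edge_pair : forall e, e \in E -> exists u v, e = [set u; v].

(** One equation gives existence and uniqueness of the partner, so only a set that matches every
    node has such a map. *)
Definition partner_map M f := forall u w, ([set u; w] \in M) = (w == f u).

Lemma matched_partner M u :
  is_matching E M -> matched M u -> exists v, [set u; v] \in M.
Proof.
case/andP => /subsetP ME _ /bigcupP [e eM ue].
have [s [t est]] := edge_pair (ME _ eM).
move: ue eM; rewrite est => /set2P [] <- eM; first by exists t.
by exists s; rewrite setUC.
Qed.

Lemma matched_edge M u v : [set u; v] \in M -> matched M u.
Proof. by move=> uvM; apply/bigcupP; exists [set u; v]; rewrite ?set21. Qed.

Lemma perfect_partner_map M :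
  is_matching E M -> (forall u, matched M u) -> exists f, partner_map M f.
Proof.
(* The default value [u] is never reached, since every node is matched. *)
move=> Mm Mp; exists (fun u => odflt u [pick v | [set u; v] \in M]) => u w.
case: pickP => [v uv|no] /=; last first.
  by have [v] := matched_partner Mm (Mp u); rewrite no.
apply/idP/eqP => [uw|-> //]; case/andP: Mm => _ tM.
exact: set2_eqr (trivIset_eq tM uw uv (set21 _ _) (set21 _ _)).
Qed.

Lemma partner_mapK M f : partner_map M f -> involutive f.
Proof. by move=> Mf u; apply/esym/eqP; rewrite -Mf setUC Mf. Qed.

Lemma partner_map_matched M f u : partner_map M f -> matched M u.
Proof. by move=> Mf; apply: (matched_edge (v := f u)); rewrite Mf. Qed.

Lemma partner_map_prefers M N f g u : partner_map M f -> partner_map N g ->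
  prefers pref u M N = better pref u (f u) (g u).
Proof.
move=> Mf Ng; rewrite /prefers (partner_map_matched u Ng) andbF /=.
apply/existsP/idP => [[v /existsP [w /and3P []]]|b].
  by rewrite Mf Ng => /eqP -> /eqP ->.
by exists (f u); apply/existsP; exists (g u); rewrite Mf Ng !eqxx.
Qed.

Lemma involution_matching g :
    involutive g -> (forall u, [set u; g u] \in E) ->
  let N := [set [set u; g u] | u : V] in is_matching E N /\ partner_map N g.
Proof.
move=> gI gE N.
(* A generating pair that contains [u] comes from [u] or from [g u], and both give the same pair. *)
have NP u w x : [set x; g x] = [set u; w] -> w = g u.
  move=> e; have : u \in [set x; g x] by rewrite e set21.
  case/set2P => ux; move: e; rewrite ux; first by move/set2_eqr.
  by rewrite setUC gI => /set2_eqr.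
have NE u w : ([set u; w] \in N) = (w == g u).
  apply/imsetP/eqP => [[x _ /esym /NP //]|->]; by exists u.
split=> //; apply/andP; split.
  by apply/subsetP => e /imsetP [x _ ->].
apply/trivIsetP => A B /imsetP [x _ ->] /imsetP [y _ ->]; apply: contraR.
case/pred0Pn => z /andP [/= zx zy].
have H t : z \in [set t; g t] -> [set t; g t] = [set z; g z].
  by case/set2P => -> //; rewrite gI setUC.
by rewrite (H x zx) (H y zy).
Qed.

(* It suffices to compare [M] with perfect matchings, since a matching that
   leaves a node exposed is worse than the perfect matching [M] for that node. *)
Lemma partner_map_pareto M f : is_matching E M -> partner_map M f ->
  (forall g, involutive g -> (forall u, [set u; g u] \in E) ->
     (forall u, ~~ better pref u (f u) (g u)) -> g =1 f) ->
  pareto_optimal E pref M.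
Proof.
move=> Mm Mf opt; split=> // -[N [Nm NM MN]].
have nMN u : ~~ prefers pref u M N.
  by move/eqP: MN; rewrite cards_eq0 => /eqP /setP /(_ u); rewrite !inE => ->.
have Np u : matched N u.
  apply: contraR (nMN u) => nN.
  by rewrite /prefers nN (partner_map_matched u Mf).
have [g Ng] := perfect_partner_map Nm Np.
case/andP: (Nm) => /subsetP NE _.
have gf : g =1 f.
  apply: opt; first exact: partner_mapK Ng.
    by move=> u; apply: NE; rewrite Ng.
  by move=> u; rewrite -(partner_map_prefers u Mf Ng).
case/card_gt0P: NM => u; rewrite inE (partner_map_prefers u Ng Mf) gf.
by rewrite /better ltnn.
Qed.

(** Otherwise the edge could be added to [M]: both ends improve and every other node keeps its
    status. *)
Lemma pareto_maximal M u v : pareto_optimal E pref M -> [set u; v] \in E ->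
  ~~ matched M u -> matched M v.
Proof.
move=> [Mm opt] uvE nu; apply: contraT => nv; case: opt.
case/andP: (Mm) => ME tM; exists ([set u; v] |: M); split.
- apply/andP; split; first by rewrite subUset sub1set uvE.
  apply: (trivIsetU1 _ tM _).1 => [B BM|].
    rewrite -setI_eq0; apply/eqP/setP => w; rewrite in_set0.
    apply/negP => /setIP [/set2P [] -> wB].
    + by case/negP: nu; apply/bigcupP; exists B.
    + by case/negP: nv; apply/bigcupP; exists B.
  (* Disjoint union also needs the empty set not to be in [M]; edges are pairs. *)
  apply/negP => /(subsetP ME) /edge_pair [s [t /setP /(_ s)]].
  by rewrite in_set0 set21.
- apply/card_gt0P; exists u; rewrite inE /prefers nu andbT.
  by rewrite (matched_edge (v := v)) // setU11.
- apply/eqP; rewrite cards_eq0; apply/eqP/setP => w; rewrite !inE.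
  apply/negP => /orP [/andP [/bigcupP [B BM wB] /negP []]|].
    by apply/bigcupP; exists B => //; rewrite setU1r.
  case/existsP => s /existsP [t /and3P [sM]]; rewrite in_setU1.
  have wM := matched_edge sM.
  case/orP => [/eqP e|tMw].
    have : w \in [set u; v] by rewrite -e set21.
    by case/set2P => e'; rewrite -e' wM in nu nv.
  have -> := set2_eqr (trivIset_eq tM sM tMw (set21 _ _) (set21 _ _)).
  by rewrite /better ltnn.
Qed.

(** Since [S] is closed under [f] and [h], using [h] on [S] and [f] elsewhere gives a perfect
    matching. It improves all of [S] and changes nothing outside, so [S] must be empty. In the
    applications [S] is the node set of an alternating cycle. *)
Lemma no_improving_switch M f (S : pred V) h u0 :
    pareto_optimal E pref M -> partner_map M f ->
    (forall u, S u -> [/\ S (f u), S (h u), h (h u) = u, [set u; h u] \in E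
                        & better pref u (h u) (f u)]) ->
  ~~ S u0.
Proof.
move=> [Mm opt] Mf Sh; apply/negP => Su0; apply: opt.
pose g u := if S u then h u else f u.
have fI := partner_mapK Mf.
case/andP: (Mm) => /subsetP ME _.
have gI : involutive g.
  move=> u; rewrite /g; case Su: (S u).
    by have [_ -> ->] := Sh u Su.
  case Sfu: (S (f u)); last exact: fI.
  by have [] := Sh _ Sfu; rewrite fI Su.
have gE u : [set u; g u] \in E.
  rewrite /g; case Su: (S u); first by have [] := Sh u Su.
  by apply: ME; rewrite Mf.
have [Nm Ng] := involution_matching gI gE.
exists [set [set u; g u] | u : V]; split=> //.
  apply/card_gt0P; exists u0; rewrite inE (partner_map_prefers _ Ng Mf) /g Su0.
  by have [] := Sh u0 Su0.
apply/eqP; rewrite cards_eq0; apply/eqP/setP => u; rewrite !inE.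
rewrite (partner_map_prefers _ Mf Ng) /g; apply/negbTE; case Su: (S u).
  by have [_ _ _ _] := Sh u Su; rewrite /better -leqNgt; apply: ltnW.
by rewrite /better ltnn.
Qed.

End PartnerMaps.

(** * Gadgets, preference lists and clause cycles *)

Section Reduction.

Variables (n : nat) (psi0 : seq (3.-tuple (literal n))).
Hypothesis distinct_vars : forall C : 3.-tuple (literal n),
  C \in psi0 -> uniq (clause_vars C).
Variables sc sd : 'I_(n + n) -> seq (occ (psi psi0)).
Hypotheses (sc_order : occ_order sc) (sd_order : occ_order sd).

Local Notation F := (psi psi0).
Local Notation V := (node F).
Local Notation pr := (prefs sc sd).
Implicit Types (u v w : V) (o p : occ F) (x y : 'I_(n + n)).

Lemma edge_pair_psi (e : {set V}) : e \in edges F -> exists u v, e = [set u; v].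
Proof. by case/setUP => /imsetP [[u v] _ ->]; exists u, v. Qed.

Lemma gadget_edgesP u v :
  ([set u; v] \in gadget_edges F) = gadget_adj u v || gadget_adj v u.
Proof.
apply/imsetP/orP => [[[s t]] /[!inE] /= st e|].
  have : u \in [set s; t] by rewrite -e set21.
  case/set2P => us; move: e; rewrite us; first by move/set2_eqr ->; left.
  by rewrite [RHS]setUC => /set2_eqr ->; right.
case=> a; [exists (u, v) | exists (v, u)] => //=; rewrite ?inE //.
exact: setUC.
Qed.

(** A gadget is a 4-cycle in which [u'] lies opposite to [u]; this form lets one argument cover all
    eight kinds of nodes. *)
Lemma gadget_opposites u : exists v1 v2 u',
  [/\ v1 != v2, [set u; v1] \in gadget_edges F, [set u; v2] \in gadget_edges F
    & forall v w, v \in [:: v1; v2] -> [set v; w] \in gadget_edges F ->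
        w = u \/ w = u'].
Proof.
case: u => z; [
  exists (NB z), (NB' z), (NA' z)
  | exists (NB z), (NB' z), (NA z)
  | exists (NA z), (NA' z), (NB' z)
  | exists (NA z), (NA' z), (NB z)
  | exists (ND F z), (ND' F z), (NC' F z)
  | exists (ND F z), (ND' F z), (NC F z)
  | exists (NC F z), (NC' F z), (ND' F z)
  | exists (NC F z), (NC' F z), (ND F z) ];
  split; rewrite ?gadget_edgesP ?node_eqE /= ?eqxx //.
all: move=> v w; rewrite !inE => /orP [] /eqP ->; rewrite gadget_edgesP.
all: by case: w => t //=; rewrite ?orbF => /eqP ->; auto.
Qed.

(** Lists have no repetition, so a split of the list decides the comparison without computing
    indices. This suits c_x and d'_x, whose lists contain an arbitrary enumeration. *)
Lemma better_cat u v w s1 s2 :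
  pr u = s1 ++ s2 -> v \in s1 -> w \in s2 -> better pr u v w.
Proof.
move=> e vs ws; have := uniq_prefs distinct_vars sc_order sd_order u.
rewrite e cat_uniq => /and3P [_ /hasPn /(_ w ws) /= nws _].
rewrite /better e !index_cat vs (negbTE nws).
by apply: leq_trans (leq_addr _ _); rewrite index_mem.
Qed.

Lemma weakly_better_cat u v w s1 s2 :
    pr u = s1 ++ s2 -> v \in s1 -> [set u; w] \in edges F ->
  ~~ better pr u v w -> w \in s1.
Proof.
move=> e vs uw; have: w \in pr u by rewrite mem_prefs.
rewrite e mem_cat => /orP [//|ws]; by rewrite (better_cat e vs ws).
Qed.

Lemma mate_lshift (i : 'I_n) : mate (lshift n i) = rshift n i.
Proof. by rewrite /mate (unsplitK (inl _ i)). Qed.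

Lemma mate_rshift (i : 'I_n) : mate (rshift n i) = lshift n i.
Proof. by rewrite /mate (unsplitK (inr _ i)). Qed.

Lemma mem_clause_vars l x :
  (x \in pos_vars (f := F) l) = ((x, true) \in nth [::] (pos_clauses F) l).
Proof.
have := mem_nth [::] (ltn_ord l); rewrite mem_filter => /andP [/allP pos _].
apply/mapP/idP => [[[y b] yC ->]|xC]; last by exists (x, true).
by have /= b1 := pos _ yC; move: yC; rewrite b1.
Qed.

(** The variables of a clause are distinct, so its occurrences form a single cycle, around which one
    can argue by induction. *)
Lemma occ_next_connect o p : occ_clause o = occ_clause p ->
  exists k, p = iter k (@occ_next _ F) o.
Proof.
move=> eop; have us := pos_vars_uniq distinct_vars (occ_clause o).
have : fconnect (next (pos_vars (occ_clause o))) (occ_var o) (occ_var p).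
  rewrite (fconnect_cycle (cycle_next us) (valP o)) eop; exact: valP p.
move/iter_findex/esym; set k := findex _ _ _ => e; exists k.
have : forall j, occ_clause (iter j (@occ_next _ F) o) = occ_clause o /\
  occ_var (iter j (@occ_next _ F) o) =
    iter j (next (pos_vars (occ_clause o))) (occ_var o).
  elim=> [//|j [IHc IHv]] /=; split=> //.
  by rewrite {1}/occ_var /= IHc IHv.
move=> /(_ k) [ec ev]; apply: val_inj.
rewrite [LHS]surjective_pairing [RHS]surjective_pairing.
by congr (_, _); [rewrite -/(occ_var _) e -ev | rewrite -/(occ_clause p) -eop -ec].
Qed.

(** * From a zero-cost Pareto-optimal matching to an assignment *)

Section Forward.

Variable M : {set {set V}}.
Hypothesis optM : pareto_optimal (edges F) pr M.
Hypothesis gadgetM : M \subset gadget_edges F.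

(** By maximality both gadget neighbours of an exposed [u] are matched, necessarily to the opposite
    node [u'], which cannot have two partners. *)
Lemma gadget_matching_perfect u : matched M u.
Proof.
apply: contraT => nu; have [Mm _] := optM; case/andP: (Mm) => _ tM.
have [v1 [v2 [u' [v12 uv1 uv2 opp]]]] := gadget_opposites u.
have twin v : v \in [:: v1; v2] -> [set u; v] \in gadget_edges F ->
    [set u'; v] \in M.
  move=> vv uv; have uvE : [set u; v] \in edges F by rewrite inE uv.
  have [w vw] := matched_partner edge_pair_psi Mm
    (pareto_maximal edge_pair_psi optM uvE nu).
  have [e|<-] := opp v w vv (subsetP gadgetM _ vw); last by rewrite setUC.
  by case/negP: nu; apply: (matched_edge (v := v)); rewrite -e setUC.
have u'v1 := twin v1 (mem_head _ _) uv1.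
have u'v2 := twin v2 (mem_last v1 [:: v2]) uv2.
have e := trivIset_eq tM u'v1 u'v2 (set21 _ _) (set21 _ _).
by rewrite (set2_eqr e) eqxx in v12.
Qed.

Variable f : V -> V.
Hypothesis Mf : partner_map M f.

Lemma gadget_partner u : gadget_adj u (f u) || gadget_adj (f u) u.
Proof. by rewrite -gadget_edgesP (subsetP gadgetM) // Mf. Qed.

Lemma partner_NA o : f (NA o) = NB o \/ f (NA o) = NB' o.
Proof.
by have := gadget_partner (NA o); case: (f _) => t //=;
  rewrite orbF => /eqP ->; auto.
Qed.

Lemma partner_NC x : f (NC F x) = ND F x \/ f (NC F x) = ND' F x.
Proof.
by have := gadget_partner (NC F x); case: (f _) => t //=;
  rewrite orbF => /eqP ->; auto.
Qed.

Let fI : involutive f := partner_mapK Mf.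

(** Otherwise the edges a_{x,l} - b'_{x,l} and c_x - d'_x can be exchanged for the consistency edges
    a_{x,l} - d'_x and c_x - b'_{x,l}, and all four ends improve. *)
Lemma true_occurrence o : f (NA o) = NB' o -> f (NC F (occ_var o)) = ND F (occ_var o).
Proof.
move=> fo; case: (partner_NC (occ_var o)) => // fx.
pose S := [pred u | u \in [:: NA o; NB' o; NC F (occ_var o); ND' F (occ_var o)]].
pose h u := match u with
  | NA _ => ND' F (occ_var o) | ND' _ => NA o
  | NC _ => NB' o | NB' _ => NC F (occ_var o) | _ => u end.
suff /negP [] : ~~ S (NA o) by rewrite /= mem_head.
apply: (no_improving_switch (h := h) _ optM Mf) => u.
have osc s : occ_order s -> o \in s (occ_var o).
  by move=> so; rewrite (perm_mem (so _)) mem_enum inE.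
have fo' : f (NB' o) = NA o by rewrite -fo fI.
have fx' : f (ND' F (occ_var o)) = NC F (occ_var o) by rewrite -fx fI.
rewrite edgesP /S /= !inE => /or4P [] /eqP ->; rewrite ?(fo, fx, fo', fx') /=.
all: rewrite !node_eqE ?eqxx ?orbT; split=> //.
- by apply: (better_cat (s1 := [:: NB _; NB _; ND' F _])); rewrite // !inE eqxx ?orbT.
- by apply: (better_cat (s1 := [:: NA' _; NC F _])); rewrite // !inE eqxx ?orbT.
- apply: (better_cat (s1 := [:: ND F _, ND F _ & [seq NB' p | p <- sc (occ_var o)]])
    (s2 := [:: ND' F (occ_var o)])).
  + by rewrite /= -cats1.
  + by rewrite !inE map_f ?orbT // osc.
  + by rewrite inE.
- apply: (better_cat (s1 := NC' F _ :: [seq NA p | p <- sd (occ_var o)])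
    (s2 := [:: NC F (occ_var o)])).
  + by rewrite /= -cats1.
  + by rewrite !inE map_f ?orbT // osc.
  + by rewrite inE.
Qed.

(** If no variable of the clause is true, [true_occurrence] puts every a_{x,l} with b_{x,l};
    rotating along the clause edges gives all of them their first choice. *)
Lemma positive_clause l : exists2 o : occ F, occ_clause o = l &
  f (NC F (occ_var o)) = ND F (occ_var o).
Proof.
have [/existsP [o /andP [/eqP ol /eqP]]|/existsPn none] :=
  boolP [exists o : occ F, (occ_clause o == l) && (f (NC F (occ_var o)) == ND F (occ_var o))].
  by exists o.
have fa o : occ_clause o = l -> f (NA o) = NB o.
  move=> ol; case: (partner_NA o) => // /true_occurrence e.
  by have := none o; rewrite ol e !eqxx.
have fb o : occ_clause o = l -> f (NB o) = NA o by move=> /fa <-; rewrite fI.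
pose S u := match u with NA o | NB o => occ_clause o == l | _ => false end.
pose h u := match u with NA o => NB (occ_prev o) | NB o => NA (occ_next o)
  | _ => u end.
(* The switching set is nonempty because the clause is. *)
have [x xl] : exists x, x \in pos_vars l.
  by have := pos_vars_size l; case: (pos_vars l) => // x s _; exists x; rewrite mem_head.
pose o : occ F := exist (fun q => q.1 \in pos_vars q.2) (x, l) xl.
suff /negP [] : ~~ S (NA o) by rewrite /= /occ_clause /=.
apply: (no_improving_switch (h := h) _ optM Mf) => u.
case: u => // {x xl} {}o /eqP ol; rewrite ?fa ?fb //= ol eqxx edgesP /=.
- rewrite (occ_prevK distinct_vars) eqxx ?orbT; split=> //; first exact/eqP.
  by apply: (better_cat (s1 := [:: NB _])); rewrite // !inE eqxx ?orbT.
- rewrite (occ_nextK distinct_vars) eqxx ?orbT; split=> //; first exact/eqP.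
  by apply: (better_cat (s1 := [:: NA _])); rewrite // !inE eqxx ?orbT.
Qed.

(** With y the mate of x, exchanging c_x - d_x and c_y - d_y for c_x - d_y and c_y - d_x gives all
    four nodes their first choice. *)
Lemma negative_clause x : f (NC F x) = ND F x ->
  f (NC F (mate x)) = ND F (mate x) -> False.
Proof.
move=> fx fy.
have fx' : f (ND F x) = NC F x by rewrite -fx fI.
have fy' : f (ND F (mate x)) = NC F (mate x) by rewrite -fy fI.
pose S u := match u with NC y | ND y => y \in [:: x; mate x] | _ => false end.
pose h u := match u with NC y => ND F (mate y) | ND y => NC F (mate y)
  | _ => u end.
suff /negP [] : ~~ S (NC F x) by rewrite /= mem_head.
apply: (no_improving_switch (h := h) _ optM Mf).
case=> // y; rewrite edgesP /= !inE => /orP [] /eqP ->.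
all: rewrite ?(fx, fy, fx', fy') /= !inE ?neg_pair_psi ?mateK !eqxx ?orbT.
all: split=> //.
- by apply: (better_cat (s1 := [:: ND F _])); rewrite // !inE eqxx ?orbT.
- by apply: (better_cat (s1 := [:: ND F _])); rewrite //= !inE ?mateK eqxx ?orbT.
- by apply: (better_cat (s1 := [:: NC F _])); rewrite // !inE eqxx ?orbT.
- by apply: (better_cat (s1 := [:: NC F _])); rewrite //= !inE ?mateK eqxx ?orbT.
Qed.

Lemma partner_map_satisfiable : satisfiable F.
Proof.
exists (fun x => f (NC F x) == ND F x); apply/allP => C CF.
have [posC|] := boolP (C \in pos_clauses F).
  have lt : index C (pos_clauses F) < size (pos_clauses F) by rewrite index_mem.
  have [o ol fo] := positive_clause (Ordinal lt).
  apply/hasP; exists (occ_var o, true); last by rewrite fo eqxx.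
  by have := valP o; rewrite mem_clause_vars -/(occ_clause o) ol /= nth_index.
have : C \in pos_clauses F
    ++ [seq [:: (lshift n i, false); (rshift n i, false)] | i <- enum 'I_n].
  by rewrite pos_clauses_psi -catA.
rewrite mem_cat => /orP [-> //|] /mapP [i _ ->] _ /=; rewrite orbF !eqbF_neg -negb_and.
apply/negP => /andP [/eqP fi /eqP]; rewrite -mate_lshift.
exact: negative_clause.
Qed.

End Forward.

(** * From a satisfying assignment to a Pareto-optimal matching *)

Section Backward.

Variable a : 'I_(n + n) -> bool.
Hypothesis sat : all (has (fun l => a l.1 == l.2)) F.

Lemma sat_mate x : a (mate x) = ~~ a x.
Proof.
have H (i : 'I_n) : a (rshift n i) = ~~ a (lshift n i).
  have /= := allP sat [:: (lshift n i, true); (rshift n i, true)].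
  have /= := allP sat [:: (lshift n i, false); (rshift n i, false)].
  rewrite /psi !mem_cat !(@map_f _ _ (fun i => [:: (_ i, _); (_ i, _)])) ?mem_enum ?orbT //.
  by move=> /(_ isT) neg /(_ isT); move: neg; case: (a _); case: (a _).
rewrite -[x]splitK; case: (split x) => i /=; first by rewrite mate_lshift.
by rewrite mate_rshift H negbK.
Qed.

Lemma sat_positive_clause l : exists2 o : occ F, occ_clause o = l & a (occ_var o).
Proof.
have := mem_nth [::] (ltn_ord l); rewrite mem_filter => /andP [/allP pos CF].
have /hasP [[x b] xC /eqP /= ab] := allP sat _ CF.
have /= b1 := pos _ xC; rewrite b1 in xC ab.
have xl : x \in pos_vars l by rewrite mem_clause_vars.
by exists (exist (fun q => q.1 \in pos_vars q.2) (x, l) xl).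
Qed.

(** Every occurrence gadget copies the state of its variable, so consistency holds by
    construction. *)
Definition sat_partner u : V :=
  match u with
  | NA o => if a (occ_var o) then NB' o else NB o
  | NA' o => if a (occ_var o) then NB o else NB' o
  | NB o => if a (occ_var o) then NA' o else NA o
  | NB' o => if a (occ_var o) then NA o else NA' o
  | NC x => if a x then ND F x else ND' F x
  | NC' x => if a x then ND' F x else ND F x
  | ND x => if a x then NC F x else NC' F x
  | ND' x => if a x then NC' F x else NC F x
  end.

Lemma sat_partnerK : involutive sat_partner.
Proof. by case=> z /=; case: ifP => /= ->. Qed.

Lemma sat_partner_gadget u : [set u; sat_partner u] \in gadget_edges F.
Proof. by rewrite gadget_edgesP; case: u => z /=; case: ifP; rewrite /= eqxx. Qed.

(** * Rigidity: a perfect matching [g] that is worse for no node *)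

Section Frozen.

Variable g : V -> V.
Hypotheses (gI : involutive g) (gE : forall u, [set u; g u] \in edges F).
Hypothesis weak : forall u, ~~ better pr u (sat_partner u) (g u).

Let gK u v : g u = v -> g v = u. Proof. by move=> <-. Qed.

Let weakP u s1 s2 : pr u = s1 ++ s2 -> sat_partner u \in s1 -> g u \in s1.
Proof. by move=> e fs; apply: weakly_better_cat e fs (gE u) (weak u). Qed.

(** Here and in the next three lemmas the node already has its first choice, so a prefix of length
    one determines its partner. *)
Lemma frozen_NC' x : ~~ a x -> g (NC' F x) = ND F x.
Proof.
move=> ax; apply/eqP; rewrite -mem_seq1.
by apply: weakP; rewrite //= (negbTE ax) mem_head.
Qed.

Lemma frozen_ND' x : a x -> g (ND' F x) = NC' F x.
Proof.
by move=> ax; apply/eqP; rewrite -mem_seq1; apply: weakP; rewrite //= ax mem_head.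
Qed.

Lemma frozen_NA' o : a (occ_var o) -> g (NA' o) = NB o.
Proof.
by move=> ax; apply/eqP; rewrite -mem_seq1; apply: weakP; rewrite //= ax mem_head.
Qed.

Lemma frozen_NB' o : ~~ a (occ_var o) -> g (NB' o) = NA' o.
Proof.
move=> ax; apply/eqP; rewrite -mem_seq1.
by apply: weakP; rewrite //= (negbTE ax) mem_head.
Qed.

(** Only d of the mate would be better, and it is held by c' of the mate, which is false. *)
Lemma frozen_NC_true x : a x -> g (NC F x) = ND F x.
Proof.
move=> ax; have: g (NC F x) \in [:: ND F (mate x); ND F x].
  by apply: weakP; rewrite //= ax !inE eqxx orbT.
rewrite !inE => /orP [] /eqP // /gK.
by rewrite (gK (frozen_NC' _)) // sat_mate ax.
Qed.

(** Here c_x has its last choice, so preferences give nothing. Instead every other neighbour is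
    taken: d of the mate by c of the mate, d_x by c'_x, and each b'_{x,l} by a'_{x,l}. *)
Lemma frozen_NC_false x : ~~ a x -> g (NC F x) = ND' F x.
Proof.
move=> ax; have := gE (NC F x); rewrite -(mem_prefs distinct_vars sc_order sd_order) /=.
rewrite !in_cons mem_rcons in_cons => /or4P [] /eqP //.
- by move/gK; rewrite (gK (frozen_NC_true _)) ?sat_mate // => -[] /eqP;
    rewrite (negbTE (mate_neq _)).
- by move/gK; rewrite (gK (frozen_NC' _)).
- move/eqP; rewrite mem_map_occ // => /existsP [o /andP [/eqP e /eqP ox]].
  by move/gK: e; rewrite frozen_NB' // ox.
Qed.

(** Again a last choice: a'_{x,l} is held by b_{x,l} and c_x by d_x. *)
Lemma frozen_NB'_true o : a (occ_var o) -> g (NB' o) = NA o.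
Proof.
move=> ax; have := gE (NB' o); rewrite -(mem_prefs distinct_vars sc_order sd_order) /=.
rewrite !inE => /or3P [] /eqP // /gK; first by rewrite frozen_NA'.
by rewrite frozen_NC_true.
Qed.

(** A clause edge at [o1] makes its variable false. Then b of [o1] must get one of its top two
    choices; the second is taken by b of [o], so the next clause edge is used as well. *)
Lemma rotated_next o : g (NA (occ_next o)) = NB o ->
  g (NA (occ_next (occ_next o))) = NB (occ_next o).
Proof.
set o1 := occ_next o => go.
have ao1 : ~~ a (occ_var o1).
  by apply/negP => /frozen_NB'_true /gK; rewrite go.
have : g (NB o1) \in [:: NA (occ_next o1); NA o1].
  by apply: weakP; rewrite //= (negbTE ao1) !inE eqxx orbT.
rewrite !inE => /orP [] /eqP /gK // e.
(* The b nodes of [o] and [o1] would coincide, though they are separate entries of one list without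
   repetition. *)
have := uniq_prefs distinct_vars sc_order sd_order (NA o1).
by rewrite /= (occ_nextK distinct_vars) -go e mem_head.
Qed.

(** A rotation would spread around the whole clause, but at a true occurrence b_{x,l} is held by
    a'_{x,l}. This is where the positive clauses being satisfied enters. *)
Lemma not_rotated o : g (NA (occ_next o)) <> NB o.
Proof.
move=> go; have [p po ap] := sat_positive_clause (occ_clause o).
have [k pk] := occ_next_connect (esym po).
have : g (NA (occ_next p)) = NB p.
  by rewrite pk; elim: k {pk} => //= k; apply: rotated_next.
by move/gK; rewrite (gK (frozen_NA' ap)).
Qed.

Lemma frozen_NA_false o : ~~ a (occ_var o) -> g (NA o) = NB o.
Proof.
move=> ax; have: g (NA o) \in [:: NB (occ_prev o); NB o].
  by apply: weakP; rewrite //= (negbTE ax) !inE eqxx orbT.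
rewrite !inE => /orP [] /eqP // e.
by case: (@not_rotated (occ_prev o)); rewrite (occ_prevK distinct_vars).
Qed.

Lemma frozen u : g u = sat_partner u.
Proof.
case: u => z /=; case: ifPn => az.
- exact/gK/frozen_NB'_true.
- exact: frozen_NA_false.
- exact: frozen_NA'.
- exact/gK/frozen_NB'.
- exact/gK/frozen_NA'.
- exact/gK/frozen_NA_false.
- exact: frozen_NB'_true.
- exact: frozen_NB'.
- exact: frozen_NC_true.
- exact: frozen_NC_false.
- exact/gK/frozen_ND'.
- exact: frozen_NC'.
- exact/gK/frozen_NC_true.
- exact/gK/frozen_NC'.
- exact: frozen_ND'.
- exact/gK/frozen_NC_false.
Qed.

End Frozen.

End Backward.

End Reduction.

Theorem theorem7 (n : nat) (psi0 : seq (3.-tuple (literal n)))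
  (distinct_vars : forall C : 3.-tuple (literal n),
     C \in psi0 -> uniq (clause_vars C))
  (sc sd : 'I_(n + n) -> seq (occ (psi psi0)))
  (sc_order : occ_order sc) (sd_order : occ_order sd) :
  (exists M : {set {set node (psi psi0)}},
     pareto_optimal (edges (psi psi0)) (prefs sc sd) M /\
     matching_cost (@edge_cost _ (psi psi0)) M = 0) <->
  satisfiable (psi psi0).
Proof.
split=> [[M [optM cost0]]|[a sat]].
  have gadgetM : M \subset gadget_edges (psi psi0).
    (* The sum vanishes termwise, and an edge outside the gadgets costs 1. *)
    apply/subsetP => e eM; move/eqP: cost0; rewrite sum_nat_eq0.
    by move/forallP/(_ e); rewrite eM /edge_cost; case: ifP.
  have [Mm _] := optM.
  have [f Mf] := perfect_partner_map (@edge_pair_psi _ _) Mm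
    (gadget_matching_perfect optM gadgetM).
  exact (partner_map_satisfiable distinct_vars sc_order sd_order optM gadgetM Mf).
have fE u : [set u; sat_partner a u] \in edges (psi psi0).
  by rewrite inE sat_partner_gadget.
have [Mm Mf] := involution_matching (@sat_partnerK _ psi0 a) fE.
exists [set [set u; sat_partner a u] | u : node (psi psi0)]; split.
  apply: (partner_map_pareto (@edge_pair_psi _ _) Mm Mf) => g gI gE weak u.
  exact: (frozen distinct_vars sc_order sd_order sat gI gE weak).
apply: big1 => e /imsetP [u _ ->].
by rewrite /edge_cost sat_partner_gadget.
Qed.
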